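(* Let $0<q<1$, let $a,b$ be nonzero, and for an integer $n\ge 0$ write $$S_n(x;a,b)=\sum_{k=0}^{n}\binom nk\varphi_k(x;a)\varphi_{n-k}(x;b),\qquad x_0(\alpha)=\tfrac12(\alpha+\alpha^{-1}).$$ Then $$S_n(x_0(a);a,b)=(ab;q)_n\,(b/a;q)_n,\qquad S_n(x_0(b);a,b)=(ab;q)_n\,(a/b;q)_n .$$ Assume $(b/a;q)_n\neq(a/b;q)_n$; this holds, for example, whenever $0<b<a<1$ and $a/b<q^{-1}$, since then $(b/a;q)_n>0>(a/b;q)_n$, and in general the excluded set is a finite union of curves in the $(a,b)$-plane containing $a=b$. Then, for $n\ge1$: (i) $S_n(\cdot\,;a,b)$ is not constant: the binomially normalised family $\{\widetilde{\mathcal B}^{\,n}_k\}_{k=0}^n$ is not a partition of unity, and no single common scalar multiple $c\,\widetilde{\mathcal B}^{\,n}_k$ makes it one. (ii) If moreover $a^2\notin\{q^{-t}:1\le t\le 2n-1\}$, $ab\notin\{q^{-t}:0\le t\le n-1\}$ and $a/b\notin\{q^{j}:|j|\le n-1\}$, then $\{\widetilde{\mathcal B}^{\,n}_k\}_{k=0}^n$ is a basis of $\Pi_n$ and there is exactly one $k$-dependent normalisation summing to unity, namely $1=\sum_{k=0}^n\pi_{n,k}\widetilde{\mathcal B}^{\,n}_k$ with the explicit coefficients $$\pi_{n,k}=\frac{q^{k}}{\binom nk}\begin{bmatrix}n\\k\end{bmatrix}_q\frac{1-\frac ba q^{\,n-2k}}{(ab;q)_n\,(b/a;q)_{n-k}\,\bigl(1-\frac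 ba q^{\,n-k}\bigr)\,(\frac ab q;q)_k}$$ (apparent singularities at special parameter values being interpreted by rational continuation). (iii) Under the assumptions of (ii) and the additional conditions $0<a,b<1$, $q<a/b<q^{-1}$, $a\ne b$, this unique normalisation is not a Bernstein-type (nonnegative) partition of unity: each $\widetilde{\mathcal B}^{\,n}_k$ is strictly positive on $[-1,1]$, whereas $\pi_{n,0}\pi_{n,n}<0$, so some functions $\pi_{n,k}\widetilde{\mathcal B}^{\,n}_k$ are negative on all of $[-1,1]$. An analogous endpoint obstruction can be formulated for the Wilson generalized powers $\rho_k(x;a)=\prod_{j=0}^{k-1}((a+j)^2+x^2)$ on the quadratic lattice (no separate theorem is stated for it).
   Context: Notation: $(c;q)_0=1$, $(c;q)_k=\prod_{j=0}^{k-1}(1-cq^j)$, $(c_1,\dots,c_r;q)_k=\prod_i (c_i;q)_k$. The $q$-binomial coefficient is $\begin{bmatrix}n\\k\end{bmatrix}_q=\frac{(q;q)_n}{(q;q)_k(q;q)_{n-k}}$. $\Pi_n$ is the space of complex polynomials of degree at most $n$ in the variable $x$. With $x=\cos\theta=\frac12(z+z^{-1})$, $z=e^{i\theta}$, the Askey–Wilson monomials are $$\varphi_k(x;a)=(az,a/z;q)_k=\prod_{j=0}^{k-1}(1-2aq^jx+a^2q^{2j}),$$ and the binomially normalised generalized-power Bernstein family is $\widetilde{\mathcal B}^{\,n}_k(x;a,b)=\binom nk\varphi_k(x;a)\varphi_{n-k}(x;b)$, $0\le k\le n$. A family of functions is a partition of unity if the functions sum to the constant $1$. A quadratic lattice is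 a map $s\mapsto c_2s^2+c_1s+c_0$.
   Formalization: Part (i) is stated for a, b real, or for complex a, b with (ab;q)_n ≠ 0; for other complex a, b it can fail (n=2, ab=1/q, a²+b²=−2/q² gives S_2 = 0 identically). *)

(* Defs.v *)
From mathcomp Require Import all_boot all_order all_algebra.
From mathcomp Require Export qpoly polyXY complex.
From mathcomp Require Export reals.
From mathcomp Require Import ring.
Set Implicit Arguments.
Unset Strict Implicit.
Unset Printing Implicit Defensive.
Import Order.TTheory GRing.Theory Num.Theory.
Local Open Scope ring_scope.

(* Complex numbers are [R[i]] for [R : realType].  For the order on [R[i]],
   [x < y] means that [x] and [y] have the same imaginary part and
   [Re x < Re y]; in particular [0 < x] and [x < 1] each force [x] to be real,
   and [-1 <= x <= 1] says that [x] lies in the real segment [-1, 1]. *)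

Section Definitions.
Variable F : fieldType.
Implicit Types (q a b c x z : F) (n k : nat).

Definition qpoch c q n : F := \prod_(j < n) (1 - c * q ^+ j).

Definition qbinom n k q : F :=
  qpoch q q n / (qpoch q q k * qpoch q q (n - k)).

Definition x0 c : F := (c + c^-1) / 2%:R.

Definition aw_monomial q k a : {poly F} :=
  \prod_(j < k) (1 - (2%:R * a * q ^+ j) *: 'X + (a ^+ 2 * q ^+ (2 * j))%:P).

Definition bern q n a b k : {poly F} :=
  'C(n, k)%:R *: (aw_monomial q k a * aw_monomial q (n - k) b).

Definition bern_sum q n a b : {poly F} := \sum_(k < n.+1) bern q n a b k.

Definition partition_of_unity n (f : 'I_n.+1 -> {poly F}) : Prop :=
  \sum_(k < n.+1) f k = 1.

(* The exponent [n - 2k] may be negative.  Division by zero gives zero, so this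
   is the intended value only where the denominator does not vanish. *)
Definition pi_formula q n k a b : F :=
  q ^+ k / 'C(n, k)%:R * qbinom n k q * (1 - b / a * q ^ (n%:Z - (2 * k)%:Z))
  / (qpoch (a * b) q n * qpoch (b / a) q (n - k)
     * (1 - b / a * q ^+ (n - k)) * qpoch (a / b * q) q k).

(* [v] is the value at [(a, b)] of the rational function that [f] represents:
   [f] agrees with the quotient [N / D] of two polynomials off a proper
   algebraic subset [E = 0] of the plane, and [D] does not vanish at [(a, b)].
   Uniqueness of [v] is [rational_value_uniq] below. *)
Definition rational_value (f : F -> F -> F) a b v : Prop :=
  exists N D E : {poly {poly F}},
    [/\ E != 0,
        forall a' b', E.[a', b'] != 0 ->
          D.[a', b'] != 0 /\ f a' b' = N.[a', b'] / D.[a', b'],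
        D.[a, b] != 0
      & v = N.[a, b] / D.[a, b]].

Lemma aw_monomialE q k a z : 2%:R != 0 :> F -> z != 0 ->
  (aw_monomial q k a).[x0 z] = qpoch (a * z) q k * qpoch (a / z) q k.
Proof.
move=> n2 nz; rewrite /aw_monomial horner_prod -big_split /=.
apply: eq_bigr => j _.
rewrite !(hornerD, hornerN, hornerC, hornerZ, hornerX) /x0 mulnC exprM.
by field; rewrite nz n2.
Qed.

Lemma size_aw_monomial q k a : (size (aw_monomial q k a) <= k.+1)%N.
Proof.
elim: k => [|k IHk]; first by rewrite /aw_monomial big_ord0 size_poly1.
rewrite /aw_monomial big_ord_recr /= -/(aw_monomial q k a).
set r := (X in aw_monomial q k a * X).
have r_le2 : (size r <= 2)%N.
  rewrite (leq_trans (size_polyD _ _)) // geq_max; apply/andP; split.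
    rewrite (leq_trans (size_polyD _ _)) // geq_max size_poly1 /= size_polyN.
    by rewrite (leq_trans (size_scale_leq _ _)) ?size_polyX.
  by rewrite (leq_trans (size_polyC_leq1 _)).
apply: leq_trans (size_polyMleq _ _) _.
by rewrite -subn1 leq_subLR add1n -addn2 leq_add.
Qed.

Lemma size_bern q n a b (k : 'I_n.+1) :
  bern q n a b k \is a poly_of_size n.+1.
Proof.
rewrite qualifE /= (leq_trans (size_scale_leq _ _)) //.
apply: leq_trans (size_polyMleq _ _) _.
rewrite -subn1 leq_subLR add1n.
apply: leq_trans (leq_add (size_aw_monomial _ _ _) (size_aw_monomial _ _ _)) _.
by rewrite addSn addnS subnKC // -ltnS.
Qed.

(* [{poly_n.+1 F}] is the space of polynomials of degree at most [n]. *)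
Definition bern_family q n a b : (n.+1).-tuple {poly_n.+1 F} :=
  [tuple NPoly (size_bern q a b k) | k < n.+1].
End Definitions.

Section Ordered.
Variable C : numFieldType.

Definition bernstein_partition n (f : 'I_n.+1 -> {poly C}) : Prop :=
  partition_of_unity f /\
  forall k (x : C), -1 <= x <= 1 -> 0 <= (f k).[x].

Lemma poly_nonroot (p : {poly C}) : p != 0 -> exists x, p.[x] != 0.
Proof.
move=> p0; pose s := [seq (i%:R : C) | i <- iota 0 (size p)].
have us : uniq s.
  by rewrite map_inj_uniq ?iota_uniq // => i j /eqP; rewrite eqr_nat => /eqP.
have : ~~ all (root p) s.
  apply/negP => rs; have := max_poly_roots p0 rs us.
  by rewrite size_map size_iota ltnn.
by case/allPn => x _ px; exists x.
Qed.

Lemma poly2_nonroot (p : {poly {poly C}}) :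
  p != 0 -> exists x y, p.[x, y] != 0.
Proof.
move=> p0; have lp : lead_coef p != 0 by rewrite lead_coef_eq0.
have [y py] := poly_nonroot lp.
have : map_poly (horner_eval y) p != 0.
  apply: contraNneq py => mp0.
  have := congr1 (fun r : {poly C} => r`_(size p).-1) mp0.
  by rewrite coef_map coef0 /= /horner_eval => /eqP.
case/poly_nonroot => x; rewrite -[x](hornerC x y) => px; exists x, y.
by move: px; rewrite -[(x%:P).[y]]/(horner_eval y x%:P) horner_map.
Qed.

Lemma rational_value_uniq (f : C -> C -> C) a b v v' :
  rational_value f a b v -> rational_value f a b v' -> v = v'.
Proof.
move=> [N [D [E [E0 fE Dab ->]]]] [N' [D' [E' [E'0 fE' D'ab ->]]]].
have eND : N * D' = N' * D.
  apply/eqP; rewrite -subr_eq0; apply/negP => /negP ne.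
  have [|x [y]] := @poly2_nonroot ((N * D' - N' * D) * (E * E')).
    by rewrite !mulf_neq0.
  rewrite !hornerM !mulf_eq0 !negb_or => /and3P[H Ex E'x].
  have [Dx fx] := fE _ _ Ex; have [D'x f'x] := fE' _ _ E'x.
  move: H; rewrite !hornerE subr_eq0 -eqr_div // -fx -f'x eqxx //.
by apply/eqP; rewrite eqr_div // -!hornerM eND.
Qed.
End Ordered.

(* Main.v *)
Require Import Defs.
From mathcomp Require Import all_boot all_order all_algebra.
From mathcomp Require Import ring zify.
Import Order.TTheory GRing.Theory Num.Theory.
Local Open Scope ring_scope.
Set Implicit Arguments.
Unset Strict Implicit.
Unset Printing Implicit Defensive.

(* The single-factor identity
     1 = u_A / ((1 - A B) (1 - A / B)) + u_B / ((1 - A B) (1 - B / A)),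
   where u_c = 1 - 2 c x + c^2, A = a q^k and B = b q^m, splits
   phi_k(x; a) phi_m(x; b) into two products of total degree k + m + 1.
   Starting from 1 = 1 and iterating, induction on n expands 1 in the products
   with k + m = n; the coefficients satisfy a Pascal-type recurrence, solved by
     q^(-k m) [k + m, k]_q
       / ((ab; q)_(k+m) (b q^(-k) / a; q)_m (a q^(-m) / b; q)_k).
   In this form every denominator is nonzero under the hypotheses of (ii), and
   reversing the last q-shifted factorial turns it into pi_(n,k).  The products
   are linearly independent: at x_0(a) only the term k = 0 survives, and the
   other terms share the factor u_a, after whose removal the same argument
   applies to the pair (aq, b).
   If S_n is constant, its values at x_0(a) and x_0(b) force the constant and
   (ab; q)_n to vanish; for real a and b this makes ab positive, and then S_n
   is positive at x = -1 or at x = 1. *)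

(** * Finite q-shifted factorials and their reversal *)

Section QPochhammer.
Variable F : fieldType.
Implicit Types (q a b c r x : F) (n k m : nat).

Lemma qpoch0 c q : qpoch c q 0 = 1.
Proof. by rewrite /qpoch big_ord0. Qed.

Lemma qpochSr c q n : qpoch c q n.+1 = qpoch c q n * (1 - c * q ^+ n).
Proof. by rewrite /qpoch big_ord_recr. Qed.

Lemma qpochSl c q n : qpoch c q n.+1 = (1 - c) * qpoch (c * q) q n.
Proof.
rewrite /qpoch big_ord_recl expr0 mulr1; congr (_ * _).
by apply: eq_bigr => j _; rewrite exprS mulrA.
Qed.

Lemma qpoch1 q n : qpoch 1 q n.+1 = 0.
Proof. by rewrite qpochSl subrr mul0r. Qed.

Lemma qpoch_neq0 c q n :
  (forall j, (j < n)%N -> c * q ^+ j != 1) -> qpoch c q n != 0.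
Proof. by move=> h; apply/prodf_neq0 => j _; rewrite subr_eq0 eq_sym h. Qed.

(** Induction on [k] rests on (1 - r q^(m-k)) (1 - q^(k+1)/r) = q^(m+1) (1 - r q^(-k-1)) (1 -
    q^(k-m)/r). None of these factors is divided by, so they may vanish. *)
Lemma qpoch_reflect q r k m : q != 0 -> r != 0 ->
  q ^+ (k + k * m) * qpoch (r * q ^- k) q m.+1 * qpoch (r^-1 * q ^- m) q k
  = qpoch r q m.+1 * qpoch (r^-1 * q) q k.
Proof.
move=> q0 r0; elim: k => [|k IHk].
  by rewrite !qpoch0 invr1 !(mulr1, mul1r).
rewrite [X in _ * X * _ = _]qpochSl [qpoch (r^-1 * q ^- m) q _]qpochSr.
rewrite [qpoch (r^-1 * q) q _]qpochSr [RHS]mulrA -IHk.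
have -> : r * q ^- k.+1 * q = r * q ^- k.
  by rewrite exprS; field; rewrite expf_neq0.
rewrite [qpoch (r * q ^- k) q m.+1]qpochSr mulSn !exprD !exprS.
by field; rewrite r0 !expf_neq0 /=.
Qed.

End QPochhammer.

(** * Askey-Wilson monomials and independence of their products *)

Section AskeyWilsonMonomials.
Variable F : fieldType.
Implicit Types (q a b c r x : F) (n k m : nat).

Definition aw_factor c : {poly F} := 1 - (2%:R * c) *: 'X + (c ^+ 2)%:P.

Lemma aw_monomial0 q a : aw_monomial q 0 a = 1.
Proof. by rewrite /aw_monomial big_ord0. Qed.

Lemma aw_monomialSr q k a :
  aw_monomial q k.+1 a = aw_monomial q k a * aw_factor (a * q ^+ k).
Proof.
by rewrite /aw_monomial big_ord_recr /aw_factor /= mulrA exprMn -exprM mulnC.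
Qed.

Lemma aw_monomialSl q k a :
  aw_monomial q k.+1 a = aw_factor a * aw_monomial q k (a * q).
Proof.
rewrite /aw_monomial big_ord_recl /aw_factor /= muln0 !expr0 !mulr1.
congr (_ * _).
apply: eq_bigr => j _; rewrite /bump /= add1n mulnS exprD exprMn.
by rewrite [q ^+ j.+1]exprS !mulrA.
Qed.

Lemma aw_factorE c x : (aw_factor c).[x] = 1 - 2%:R * c * x + c ^+ 2.
Proof.
by rewrite /aw_factor !(hornerD, hornerN, hornerC, hornerZ, hornerX).
Qed.

Lemma aw_factor_neq0 c : 2%:R * c != 0 -> aw_factor c != 0.
Proof.
apply: contraNneq => /(congr1 (fun p : {poly F} => p`_1)).
rewrite /aw_factor !coefE /= mulr1 add0r addr0 => /eqP.
by rewrite oppr_eq0.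
Qed.

(** Both factors are linear in x. The weights cancel the x terms, and the constant terms combine
    through (1 + A^2) B - (1 + B^2) A = (B - A) (1 - A B). *)
Lemma aw_factor_split A B : A != 0 -> B != 0 -> A * B != 1 -> A != B ->
  1 = ((1 - A * B) * (1 - A / B))^-1 *: aw_factor A
      + ((1 - A * B) * (1 - B / A))^-1 *: aw_factor B.
Proof.
move=> A0 B0 AB1 AB.
have h1 : 1 - A * B != 0 by rewrite subr_eq0 eq_sym.
have h2 : B - A != 0 by rewrite subr_eq0 eq_sym.
have h3 : A - B != 0 by rewrite subr_eq0.
apply/polyP => i; rewrite /aw_factor !coefE.
by case: i => [|[|i]] /=; field; rewrite A0 B0 h1 h2 h3.
Qed.

Lemma aw_monomial_x0 q k a : 2%:R != 0 :> F -> a != 0 ->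
  (aw_monomial q k.+1 a).[x0 a] = 0.
Proof.
by move=> n2 a0; rewrite aw_monomialE // divff // qpoch1 mulr0.
Qed.

(** Division-free form of the exclusions on a b and a / b in (ii). It passes from (n + 1, a, b) to
    (n, a q, b), as the induction for independence requires. *)
Definition nonresonant q n a b :=
  [/\ a != 0, b != 0, forall j, (j < n)%N -> a * b * q ^+ j != 1
    & forall i j, (i < n)%N -> (j < n)%N -> a * q ^+ i != b * q ^+ j].

Lemma aw_products_free q n a b (c : nat -> F) : q != 0 -> 2%:R != 0 :> F ->
  nonresonant q n a b ->
  \sum_(k < n.+1) c k *: (aw_monomial q k a * aw_monomial q (n - k) b) = 0 ->
  forall k, (k <= n)%N -> c k = 0.
Proof.
move=> q0 n2; elim: n a c => [|n IHn] a c [a0 b0 hs hr].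
  rewrite big_ord1 !aw_monomial0 mulr1 => /(congr1 (fun p : {poly F} => p`_0)).
  by rewrite coefZ !coefE mulr1 => c0 k; rewrite leqn0 => /eqP->.
rewrite big_ord_recl subn0 aw_monomial0 mul1r.
set S := (X in _ + X) => e.
have c0 : c 0%N = 0.
  move/(congr1 (fun p : {poly F} => p.[x0 a])): (e).
  rewrite hornerD hornerZ /S horner_sum big1 ?addr0 ?horner0; last first.
    by move=> i _; rewrite hornerZ hornerM aw_monomial_x0 // mul0r mulr0.
  have nab : qpoch (b * a) q n.+1 != 0.
    by apply: qpoch_neq0 => j jn; rewrite [b * a]mulrC hs.
  have nba : qpoch (b / a) q n.+1 != 0.
    apply: qpoch_neq0 => j jn; apply: contraNneq (hr 0%N j isT jn) => h.
    by rewrite expr0 mulr1 -[a in a == _]mulr1 -h; apply/eqP; field.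
  rewrite aw_monomialE // => /eqP.
  by rewrite !mulf_eq0 (negPf nab) (negPf nba) !orbF => /eqP.
move: e; rewrite c0 scale0r add0r => e.
have {}e : aw_factor a * (\sum_(k < n.+1) c k.+1 *:
    (aw_monomial q k (a * q) * aw_monomial q (n - k) b)) = 0.
  rewrite mulr_sumr; apply: etrans e; rewrite {}/S; apply: eq_bigr => k _.
  by rewrite lift0 subSS aw_monomialSl -scalerAr mulrA.
(* The coefficient -2a of x in u_a is nonzero, so u_a can be cancelled. *)
move/eqP: e; rewrite mulf_eq0 (negPf (aw_factor_neq0 _)) ?mulf_neq0 //=.
move=> /eqP e [//|k]; apply: (IHn (a * q) (fun k => c k.+1)) e k.
split=> [||j jn|i j jn kn]; rewrite ?mulf_neq0 //.
  by have := hs j.+1 jn; rewrite exprS; congr (_ != 1); ring.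
by have := hr i.+1 j jn (ltnW kn); rewrite exprS mulrA.
Qed.

End AskeyWilsonMonomials.

(** * Expansion of 1 in the products phi_k(x; a) phi_m(x; b) *)

Section UnityCoefficients.
Variables (F : fieldType) (q : F).
Hypotheses (q0 : q != 0) (q_not_root : forall j, q ^+ j.+1 != 1).
Implicit Types (a b : F) (n k m : nat).

(** Indexing by both degrees makes the formula symmetric under exchange of (k, a) with (m, b). Its
    ratio factors are 1 - (b/a) q^(j-k) for j < m and 1 - (a/b) q^(j-m) for j < k. *)
Definition unity_coef k m a b : F :=
  q ^- (k * m) * qbinom (k + m) k q
  / (qpoch (a * b) q (k + m) * qpoch (b / a * q ^- k) q m
     * qpoch (a / b * q ^- m) q k).

Lemma qpochqq_neq0 n : qpoch q q n != 0.
Proof. by apply: qpoch_neq0 => j _; rewrite -exprS. Qed.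

Lemma qbinomn0 n : qbinom n 0 q = 1.
Proof. by rewrite /qbinom qpoch0 subn0 mul1r divff ?qpochqq_neq0. Qed.

Lemma qbinomnn n : qbinom n n q = 1.
Proof. by rewrite /qbinom subnn qpoch0 mulr1 divff ?qpochqq_neq0. Qed.

Lemma nonresonantW n a b : nonresonant q n.+1 a b -> nonresonant q n a b.
Proof.
move=> [a0 b0 hs hr]; split=> // [j /ltnW /hs //|i j /ltnW hi /ltnW hj].
exact: hr.
Qed.

(** At the boundary only one product of the previous degree contributes, so the recurrence has a
    single term. *)
Lemma unity_coef_left m a b :
  unity_coef 0 m.+1 a b
  = unity_coef 0 m a b / ((1 - a * (b * q ^+ m)) * (1 - b * q ^+ m / a)).
Proof.
rewrite /unity_coef !mul0n !add0n !qbinomn0 !expr0 !qpoch0 !qpochSr invr1.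
by rewrite !mulr1 !mul1r !invfM mulrACA !mulrA [b / a * _]mulrAC.
Qed.

Lemma unity_coef_right k a b :
  unity_coef k.+1 0 a b
  = unity_coef k 0 a b / ((1 - a * q ^+ k * b) * (1 - a * q ^+ k / b)).
Proof.
rewrite /unity_coef !muln0 !addn0 !qbinomnn !expr0 !qpoch0 !qpochSr invr1.
rewrite !mulr1 !mul1r !invfM mulrACA.
by rewrite [a * b * _]mulrAC [a / b * _]mulrAC.
Qed.

(** The product of degrees [k.+1] and [m.+1] arises by appending an a-factor to (k, m+1) or a
    b-factor to (k+1, m). The three coefficients share their q-shifted factorials up to a few end
    factors, which leaves a rational identity. *)
Lemma unity_coef_rec k m a b : nonresonant q (k + m).+2 a b ->
  unity_coef k.+1 m.+1 a b
  = unity_coef k m.+1 a b / ((1 - a * q ^+ k * (b * q ^+ m.+1))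
                            * (1 - a * q ^+ k / (b * q ^+ m.+1)))
    + unity_coef k.+1 m a b / ((1 - a * q ^+ k.+1 * (b * q ^+ m))
                            * (1 - b * q ^+ m / (a * q ^+ k.+1))).
Proof.
move=> [a0 b0 hs hr].
have nx : q ^+ k != 0 by rewrite expf_neq0.
have ny : q ^+ m != 0 by rewrite expf_neq0.
have nz : q ^+ (k * m) != 0 by rewrite expf_neq0.
have lek : (k < (k + m).+2)%N by rewrite ltnS leqW ?leq_addr.
have lem : (m < (k + m).+2)%N by rewrite ltnS leqW ?leq_addl.
have leSk : (k.+1 < (k + m).+2)%N by rewrite !ltnS leq_addr.
have leSm : (m.+1 < (k + m).+2)%N by rewrite !ltnS leq_addl.
have h1 : a * q ^+ k.+1 - b != 0.
  by rewrite subr_eq0 -[b]mulr1 -(expr0 q) hr.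
have h2 : b * q ^+ m.+1 - a != 0.
  by rewrite subr_eq0 eq_sym -[a]mulr1 -(expr0 q) hr.
have h3 : a * q ^+ k.+1 - b * q ^+ m != 0 by rewrite subr_eq0 hr.
have h4 : b * q ^+ m.+1 - a * q ^+ k != 0 by rewrite subr_eq0 eq_sym hr.
have h5 : 1 - a * b * q ^+ (k + m).+1 != 0 by rewrite subr_eq0 eq_sym hs.
have g1 : 1 - q ^+ k.+1 != 0 by rewrite subr_eq0 eq_sym.
have g2 : 1 - q ^+ m.+1 != 0 by rewrite subr_eq0 eq_sym.
have nab : qpoch (a * b) q (k + m).+1 != 0.
  by apply: qpoch_neq0 => j jk; apply/hs/leqW.
have nP : qpoch (b / a * q ^- k) q m != 0.
  apply: qpoch_neq0 => j jm; apply: contraNneq (hr k j lek (ltn_trans jm lem)).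
  by move=> e; rewrite -[a * _]mulr1 -e; apply/eqP; field; rewrite nx a0.
have nQ : qpoch (a / b * q ^- m) q k != 0.
  apply: qpoch_neq0 => j jk.
  apply: contraNneq (hr j m (ltn_trans jk lek) lem) => e.
  by rewrite -[b * _]mulr1 -e; apply/eqP; field; rewrite ny b0.
have d1 : 1 - b / a * q ^- k.+1 * q ^+ m != 0.
  have -> : 1 - b / a * q ^- k.+1 * q ^+ m
      = (a * q ^+ k.+1 - b * q ^+ m) / (a * q ^+ k.+1).
    by rewrite exprS; field; rewrite a0 q0 nx.
  by rewrite !mulf_neq0 ?invr_eq0 ?mulf_neq0 ?expf_neq0.
have d2 : 1 - a / b * q ^- m.+1 * q ^+ k != 0.
  have -> : 1 - a / b * q ^- m.+1 * q ^+ k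
      = (b * q ^+ m.+1 - a * q ^+ k) / (b * q ^+ m.+1).
    by rewrite exprS; field; rewrite b0 q0 ny.
  by rewrite !mulf_neq0 ?invr_eq0 ?mulf_neq0 ?expf_neq0.
(* Shifting the base by q trades one end factor for the other, so that a single factorial of each
   ratio remains. *)
have eP : qpoch (b / a * q ^- k.+1) q m
    = (1 - b / a * q ^- k.+1) * qpoch (b / a * q ^- k) q m
      / (1 - b / a * q ^- k.+1 * q ^+ m).
  apply/(canRL (mulfK d1)); rewrite -qpochSr qpochSl; congr (_ * qpoch _ _ _).
  by rewrite exprS; field; rewrite nx q0 a0.
have eQ : qpoch (a / b * q ^- m.+1) q k
    = (1 - a / b * q ^- m.+1) * qpoch (a / b * q ^- m) q k
      / (1 - a / b * q ^- m.+1 * q ^+ k).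
  apply/(canRL (mulfK d2)); rewrite -qpochSr qpochSl; congr (_ * qpoch _ _ _).
  by rewrite exprS; field; rewrite ny q0 b0.
rewrite /unity_coef /qbinom.
rewrite [qpoch (b / a * q ^- k.+1) q m.+1]qpochSr.
rewrite [qpoch (b / a * q ^- k) q m.+1]qpochSr.
rewrite [qpoch (a / b * q ^- m.+1) q k.+1]qpochSr.
rewrite [qpoch (a / b * q ^- m) q k.+1]qpochSr eP eQ.
have h6 : a * q ^+ k - b * q ^+ m != 0 by rewrite subr_eq0 hr.
have h7 : b * q ^+ m - a * q ^+ k != 0 by rewrite subr_eq0 eq_sym hr.
have h8 : qpoch q q k != 0 := qpochqq_neq0 _.
have h9 : qpoch q q m != 0 := qpochqq_neq0 _.
have h10 : 1 - a * (q * q ^+ k) * (b * q ^+ m) != 0.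
  by apply: contraNneq h5 => <-; rewrite !exprS exprD; apply/eqP; ring.
move: nab; rewrite qpochSr mulf_eq0 negb_or => /andP[nab nab'].
rewrite !addKn !addnS !addSn !mulnS !mulSn !qpochSr !exprD !exprS.
rewrite !exprS exprD in h1 h2 h3 h4 g1 g2 nab' *; clear d1 d2 eP eQ.
field; rewrite nx ny nz q0 a0 b0 nP nQ nab nab' h1 h2 h3 h4 h6 h7 h8 h9 h10.
by rewrite g1 g2.
Qed.

(** [aw_factor_split] at A = a q^k and B = b q^m, the parameters of the next factor of each
    monomial. *)
Lemma aw_product_split k m a b : nonresonant q (k + m).+1 a b ->
  aw_monomial q k a * aw_monomial q m b
  = ((1 - a * q ^+ k * (b * q ^+ m)) * (1 - a * q ^+ k / (b * q ^+ m)))^-1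
      *: (aw_monomial q k.+1 a * aw_monomial q m b)
    + ((1 - a * q ^+ k * (b * q ^+ m)) * (1 - b * q ^+ m / (a * q ^+ k)))^-1
      *: (aw_monomial q k a * aw_monomial q m.+1 b).
Proof.
move=> [a0 b0 hs hr]; rewrite !aw_monomialSr.
rewrite [X in _ = _ *: X + _]mulrAC [X in _ + _ *: X]mulrA !scalerAr -mulrDr.
rewrite -aw_factor_split ?mulr1 // ?mulf_neq0 ?expf_neq0 //.
  by rewrite mulrACA -exprD hs.
by rewrite hr ?ltnS ?leq_addr ?leq_addl.
Qed.

Lemma unity_coef_sum n a b : nonresonant q n a b ->
  \sum_(k < n.+1)
    unity_coef k (n - k) a b *: (aw_monomial q k a * aw_monomial q (n - k) b)
  = 1.
Proof.
elim: n => [|n IHn] hn.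
  rewrite big_ord1 !aw_monomial0 mulr1 /unity_coef !qpoch0 qbinomn0.
  by rewrite expr0 !mulr1 invr1 mulr1 scale1r.
have h1 := nonresonantW hn; rewrite -[RHS](IHn h1).
under [RHS]eq_bigr => k _.
  rewrite aw_product_split ?subnKC -1?ltnS //.
  rewrite scalerDr !scalerA -[(n - k).+1]subSn -1?ltnS //; over.
(* The product of degrees k + 1 and n - k receives the first half of term k and the second half of
   term k + 1. The two extreme products receive one half only and are split off. *)
rewrite big_split /= [in RHS]big_ord_recr [X in _ = _ + X]big_ord_recl /=.
rewrite big_ord_recl big_ord_recr /= !subn0 !subnn.
rewrite unity_coef_left unity_coef_right expr0 !mulr1.
rewrite [RHS]addrCA [X in _ = _ + X]addrAC -big_split /=.
congr (_ + (_ + _)); apply: eq_bigr => -[k kn] _ /=.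
(* Writing n = k + m + 1 removes the truncated subtractions. *)
have [m e] : exists m, n = (k + m).+1.
  by exists (n - k.+1)%N; rewrite -addSn subnKC.
rewrite e in hn *; rewrite /bump add1n !subSS -!addnS !addKn.
by rewrite -scalerDl unity_coef_rec.
Qed.

End UnityCoefficients.

(** * Closure properties of rational values *)

Section RationalValue.
Variable F : fieldType.
Implicit Types (f g : F -> F -> F) (a b c v w q : F).

(** Multiplying the exceptional polynomials allows f to be changed on a curve. With E = 1 this also
    replaces a function by a pointwise equal one, without extensionality. *)
Lemma rational_value_eq f g a b v (E : {poly {poly F}}) : E != 0 ->
  (forall x y, E.[x%:P].[y] != 0 -> f x y = g x y) ->
  rational_value f a b v -> rational_value g a b v.
Proof.
move=> E0 fg [N [D [E' [E'0 fE Dab ->]]]]; exists N, D, (E * E').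
split=> // [|x y]; first by rewrite mulf_neq0.
by rewrite !hornerM mulf_eq0 negb_or => /andP[/fg <- /fE].
Qed.

Lemma rational_value_poly (p : {poly {poly F}}) a b :
  rational_value (fun x y => p.[x%:P].[y]) a b p.[a%:P].[b].
Proof.
exists p, 1, 1.
by split=> [|x y _||]; rewrite ?oner_neq0 ?hornerE ?oner_neq0 ?divr1.
Qed.

Lemma rational_value_const c a b : rational_value (fun _ _ => c) a b c.
Proof.
have := rational_value_poly c%:P%:P a b; rewrite !hornerE.
by apply: rational_value_eq (oner_neq0 _) _ => x y _; rewrite !hornerE.
Qed.

Lemma rational_value_fst a b : rational_value (fun x _ => x) a b a.
Proof.
(* The outer variable is evaluated at a; the inner one, embedded as ['X%:P], at b. *)
have := rational_value_poly 'X a b; rewrite !hornerE.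
by apply: rational_value_eq (oner_neq0 _) _ => x y _; rewrite !hornerE.
Qed.

Lemma rational_value_snd a b : rational_value (fun _ y => y) a b b.
Proof.
have := rational_value_poly 'X%:P a b; rewrite !hornerE.
by apply: rational_value_eq (oner_neq0 _) _ => x y _; rewrite !hornerE.
Qed.

Lemma rational_valueB f g a b v w : rational_value f a b v ->
  rational_value g a b w ->
  rational_value (fun x y => f x y - g x y) a b (v - w).
Proof.
move=> [N [D [E [E0 fE Dab ->]]]] [N' [D' [E' [E'0 gE D'ab ->]]]].
exists (N * D' - N' * D), (D * D'), (E * E').
split=> [|x y||]; [by rewrite mulf_neq0| |by rewrite !hornerM mulf_neq0|].
  rewrite !(hornerD, hornerN, hornerM) mulf_eq0 negb_or.
  move=> /andP[/fE[Dx ->] /gE[D'x ->]].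
  by split; [rewrite mulf_neq0|field; rewrite Dx D'x].
by rewrite !(hornerD, hornerN, hornerM); field; rewrite Dab D'ab.
Qed.

Lemma rational_valueM f g a b v w : rational_value f a b v ->
  rational_value g a b w ->
  rational_value (fun x y => f x y * g x y) a b (v * w).
Proof.
move=> [N [D [E [E0 fE Dab ->]]]] [N' [D' [E' [E'0 gE D'ab ->]]]].
exists (N * N'), (D * D'), (E * E').
split=> [|x y||]; [by rewrite mulf_neq0| |by rewrite !hornerM mulf_neq0|].
  rewrite !hornerM mulf_eq0 negb_or => /andP[/fE[Dx ->] /gE[D'x ->]].
  by split; [rewrite mulf_neq0|field; rewrite Dx D'x].
by rewrite !hornerM; field; rewrite Dab D'ab.
Qed.

(** N becomes the denominator. Since v is nonzero, N does not vanish at (a, b), so it is a nonzero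
    polynomial and may join the exceptional set. *)
Lemma rational_valueV f a b v : v != 0 -> rational_value f a b v ->
  rational_value (fun x y => (f x y)^-1) a b v^-1.
Proof.
move=> v0 [N [D [E [E0 fE Dab ev]]]].
have Nab : N.[a%:P].[b] != 0 by apply: contraNneq v0 => h; rewrite ev h mul0r.
have N0 : N != 0 by apply: contraNneq Nab => ->; rewrite !horner0.
exists D, N, (E * N); split; rewrite ?ev ?invf_div ?mulf_neq0 // => x y.
rewrite !hornerM mulf_eq0 negb_or => /andP[/fE[Dx ->] ->].
by rewrite invf_div.
Qed.

Lemma rational_value_qpoch f q n a b v : rational_value f a b v ->
  rational_value (fun x y => qpoch (f x y) q n) a b (qpoch v q n).
Proof.
move=> fv; elim: n => [|n IHn].
  rewrite qpoch0.
  apply: rational_value_eq (oner_neq0 _) _ (rational_value_const 1 a b).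
  by move=> x y _; rewrite qpoch0.
have hc c := rational_value_const c a b; rewrite qpochSr.
apply: rational_value_eq (oner_neq0 _) _ (rational_valueM IHn
  (rational_valueB (hc 1) (rational_valueM fv (hc (q ^+ n))))).
by move=> x y _; rewrite qpochSr.
Qed.

End RationalValue.

(** * The explicit coefficients and their rational continuation *)

Section PiFormula.
Variables (F : fieldType) (q : F).
Hypothesis q0 : q != 0.
Implicit Types (a b : F) (n k m : nat).

Lemma qpoch_ratio_neq0 k m n a b : (k + m)%N = n -> nonresonant q n a b ->
  qpoch (b / a * q ^- k) q m != 0.
Proof.
move=> <- [a0 b0 hs hr]; have nx : q ^+ k != 0 by rewrite expf_neq0.
(* For m = 0 the index k equals n, outside the range of [hr], but then the factorial is empty. *)
case: m hs hr => [|m] hs hr; first by rewrite qpoch0 oner_neq0.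
apply: qpoch_neq0 => j jm; apply: contraNneq (hr k j _ _) => [e||].
- by rewrite -[a * _]mulr1 -e; apply/eqP; field; rewrite nx a0.
- by rewrite addnS ltnS leq_addr.
- by rewrite (leq_trans jm) ?leq_addl.
Qed.

Lemma nonresonantC n a b : nonresonant q n a b -> nonresonant q n b a.
Proof.
move=> [a0 b0 hs hr]; split=> // [j /hs|i j hi hj].
  by rewrite [b * a]mulrC.
by rewrite eq_sym hr.
Qed.

(* Possibly 0 = 0: the two denominators vanish for the same (a, b). *)
Lemma pi_formulaE k m a b : a != 0 -> b != 0 ->
    a * q ^+ k != b * q ^+ m ->
  pi_formula q (k + m) k a b = unity_coef q k m a b / 'C(k + m, k)%:R.
Proof.
move=> a0 b0 ab.
have nx : q ^+ k != 0 by rewrite expf_neq0.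
have ny : q ^+ m != 0 by rewrite expf_neq0.
have r0 : b / a != 0 by rewrite mulf_neq0 ?invr_eq0.
(* This is the numerator factor 1 - (b/a) q^(n-2k), which will cancel. *)
have u0 : 1 - b / a * (q ^+ m / q ^+ k) != 0.
  rewrite subr_eq0; apply: contraNneq ab => e.
  by rewrite -[a * _]mulr1 e; apply/eqP; field; rewrite nx a0.
have eq_exp : q ^ ((k + m)%:Z - (2 * k)%:Z) = q ^+ m / q ^+ k.
  have -> : (k + m)%:Z - (2 * k)%:Z = m%:Z - k%:Z by lia.
  by rewrite expfzDr // -exprnN.
rewrite /pi_formula /unity_coef eq_exp addKn.
(* With r = b/a, the last factor of the reflected product of length [m.+1] is that numerator factor;
   the others are the ratio factors of [unity_coef]. *)
have refl := qpoch_reflect k m q0 r0.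
rewrite invf_div in refl.
rewrite [qpoch (b / a * _) q m.+1]qpochSr [qpoch (b / a) q m.+1]qpochSr in refl.
have {}refl : q ^+ k * q ^+ (k * m) * (1 - b / a * (q ^+ m / q ^+ k))
     * (qpoch (b / a * q ^- k) q m * qpoch (a / b * q ^- m) q k)
   = qpoch (b / a) q m * (1 - b / a * q ^+ m) * qpoch (a / b * q) q k.
  by rewrite -refl exprD; ring.
have -> : qpoch (a * b) q (k + m) * qpoch (b / a) q m * (1 - b / a * q ^+ m)
    * qpoch (a / b * q) q k
  = q ^+ k * q ^+ (k * m) * (1 - b / a * (q ^+ m / q ^+ k))
    * (qpoch (a * b) q (k + m) * qpoch (b / a * q ^- k) q m
       * qpoch (a / b * q ^- m) q k).
  by rewrite -2![LHS]mulrA [X in _ * X = _]mulrA -refl; ring.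
have nz : q ^+ (k * m) != 0 by rewrite expf_neq0.
move: ('C(_, _)%:R^-1) => c.
(* With the inverse of the common denominator abstracted, [field] never asks whether that
   denominator vanishes. *)
rewrite invfM; move: (_ * qpoch (a / b * q ^- m) q k)^-1 => w.
move: u0; set u := 1 - _ => u0; by field; rewrite nx nz u0.
Qed.

(** Nonresonance still allows [pi_formula] to be 0/0: for k = 0 when a = b q^m, and for m = 0 when b
    = a q^k. The expression by [unity_coef] is regular there and supplies the continuation. *)
Lemma rational_value_pi k m a b : nonresonant q (k + m) a b ->
  rational_value (pi_formula q (k + m) k) a b
    (unity_coef q k m a b / 'C(k + m, k)%:R).
Proof.
move=> hab; have [a0 b0 hs hr] := hab.
have nx : q ^+ k != 0 by rewrite expf_neq0.
(* E vanishes on the axes and on the line x q^k = y q^m, exactly where [pi_formulaE] does not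
   apply. *)
pose E : {poly {poly F}} :=
  'X * 'X%:P * ((q ^+ k)%:P%:P * 'X - (q ^+ m *: 'X)%:P).
have E0 : E != 0.
  rewrite !mulf_neq0 ?polyX_eq0 ?polyC_eq0 ?polyX_eq0 //.
  apply: contraNneq nx => /(congr1 (fun p : {poly {poly F}} => p`_1)).
  rewrite coefB coefCM coefX coefC coef0 mulr1 subr0 => /eqP.
  by rewrite polyC_eq0.
pose f x y := unity_coef q k m x y / 'C(k + m, k)%:R.
apply: (rational_value_eq (f := f) E0) => [x y|].
  rewrite /E !hornerE !mulf_eq0 !negb_or => /andP[/andP[x0 y0]].
  by rewrite subr_eq0 => h; rewrite pi_formulaE // [x * _]mulrC [y * _]mulrC.
have hc c := rational_value_const c a b.
have ha := rational_value_fst a b; have hb := rational_value_snd a b.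
rewrite /f /unity_coef.
apply: rational_valueM (hc _); apply: rational_valueM (hc _) _.
apply: rational_valueV; last first.
  apply: rational_valueM; last apply: rational_value_qpoch.
    apply: rational_valueM; apply: rational_value_qpoch.
      exact: rational_valueM.
    by apply: rational_valueM (hc _);
      apply: rational_valueM hb _; apply: rational_valueV.
  by apply: rational_valueM (hc _);
    apply: rational_valueM ha _; apply: rational_valueV.
rewrite !mulf_neq0 //; first exact: qpoch_neq0.
  exact: qpoch_ratio_neq0 (erefl _) hab.
by apply: qpoch_ratio_neq0 (addnC _ _) (nonresonantC hab).
Qed.

End PiFormula.

(** * Special values of S_n and the excluded parameters *)

Section BernsteinFamily.
Variables (F : fieldType) (q : F).
Hypothesis n2 : 2%:R != 0 :> F.
Implicit Types (a b c : F) (n k m : nat).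

(** Every term with k > 0 contains u_a, which vanishes at x_0(a). *)
Lemma bern_sum_x0l n a b : a != 0 ->
  (bern_sum q n a b).[x0 a] = qpoch (a * b) q n * qpoch (b / a) q n.
Proof.
move=> a0; rewrite /bern_sum big_ord_recl hornerD horner_sum big1 => [|k _].
  rewrite addr0 hornerZ hornerM bin0 subn0 aw_monomial0 hornerC !mul1r.
  by rewrite aw_monomialE // mulrC [b * a]mulrC mulrC.
by rewrite hornerZ hornerM lift0 aw_monomial_x0 // mul0r mulr0.
Qed.

Lemma bern_sum_x0r n a b : b != 0 ->
  (bern_sum q n a b).[x0 b] = qpoch (a * b) q n * qpoch (a / b) q n.
Proof.
move=> b0; rewrite /bern_sum big_ord_recr hornerD horner_sum big1 => [|k _] /=.
  rewrite add0r hornerZ hornerM binn subnn aw_monomial0 hornerC mulr1 mul1r.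
  by rewrite aw_monomialE.
rewrite hornerZ hornerM -[(n - k)%N]prednK ?subn_gt0 //.
by rewrite aw_monomial_x0 // !mulr0.
Qed.

(** Equality of the two special values forces (ab; q)_n = 0, and then both are 0; that case is
    settled separately by positivity. *)
Lemma bern_sum_eqC n a b c : a != 0 -> b != 0 ->
    qpoch (b / a) q n != qpoch (a / b) q n -> bern_sum q n a b = c%:P ->
  c = 0 /\ qpoch (a * b) q n = 0.
Proof.
move=> a0 b0 ab e; have := bern_sum_x0r n a b0; have := bern_sum_x0l n b a0.
rewrite e !hornerC => -> /eqP; rewrite -subr_eq0 -mulrBr mulf_eq0 subr_eq0.
by rewrite (negPf ab) orbF => /eqP->; rewrite mul0r.
Qed.

Lemma unity_coef0n n a b : (forall j, q ^+ j.+1 != 1) ->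
  unity_coef q 0 n a b = (qpoch (a * b) q n * qpoch (b / a) q n)^-1.
Proof.
move=> hq; rewrite /unity_coef mul0n add0n qbinomn0 // qpoch0 expr0 invr1.
by rewrite !mulr1 mul1r.
Qed.

Lemma unity_coefn0 n a b : (forall j, q ^+ j.+1 != 1) ->
  unity_coef q n 0 a b = (qpoch (a * b) q n * qpoch (a / b) q n)^-1.
Proof.
move=> hq; rewrite /unity_coef muln0 addn0 qbinomnn // qpoch0 expr0 invr1.
by rewrite !mulr1 mul1r.
Qed.

(** With t = b/a, multiply (t; q)_n = (1/t; q)_n by t^n. The excluded pairs then lie on the lines b
    = t a through the roots t. *)
Lemma qpoch_ratio_eq_roots n : q != 0 -> (0 < n)%N ->
  exists2 p : {poly F}, p != 0 & forall a b, a != 0 -> b != 0 ->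
    root p (b / a) = (qpoch (b / a) q n == qpoch (a / b) q n).
Proof.
move=> q0 n0.
exists ('X^n * \prod_(j < n) (1 - q ^+ j *: 'X)
        - \prod_(j < n) ('X - (q ^+ j)%:P)).
  (* At 0 the first product is killed by its power of the variable, as n > 0, while the second is a
     product of the nonzero -q^j. *)
  apply/eqP => /(congr1 (fun p : {poly F} => p.[0])); apply/eqP.
  rewrite !(hornerD, hornerN, hornerM) hornerXn expr0n eqn0Ngt n0 mul0r sub0r.
  rewrite horner0 oppr_eq0 horner_prod; apply/prodf_neq0 => j _.
  by rewrite hornerXsubC sub0r oppr_eq0 expf_neq0.
move=> a b a0 b0; have t0 : b / a != 0 by rewrite mulf_neq0 ?invr_eq0.
rewrite rootE !(hornerD, hornerN, hornerM) hornerXn !horner_prod.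
have -> : \prod_(j < n) (1 - q ^+ j *: 'X).[b / a] = qpoch (b / a) q n.
  apply: eq_bigr => j _.
  by rewrite !(hornerD, hornerN, hornerZ, hornerC, hornerX) mulrC.
have -> : \prod_(j < n) ('X - (q ^+ j)%:P).[b / a]
    = (b / a) ^+ n * qpoch (a / b) q n.
  rewrite -[in X in _ ^+ X](card_ord n) -prodr_const -big_split /=.
  by apply: eq_bigr => j _; rewrite hornerXsubC; field; rewrite a0 b0.
by rewrite -mulrBr mulf_eq0 expf_eq0 (negPf t0) andbF /= subr_eq0.
Qed.

End BernsteinFamily.

(** * The Bernstein family as a basis *)

Section BernsteinBasis.
Variables (F : fieldType) (q : F).
Hypotheses (q0 : q != 0) (charF : forall n, n.+1%:R != 0 :> F).
Implicit Types (a b : F) (n k m : nat).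

Lemma bin_neq0 n k : (k <= n)%N -> 'C(n, k)%:R != 0 :> F.
Proof. by rewrite -bin_gt0; case: 'C(n, k). Qed.

Lemma bern_free n a b (c : 'I_n.+1 -> F) : nonresonant q n a b ->
  \sum_(k < n.+1) c k *: bern q n a b k = 0 -> forall k : 'I_n.+1, c k = 0.
Proof.
move=> hab e k.
have kn : (k <= n)%N by rewrite -ltnS.
(* [inord] extends the ordinal-indexed coefficients to all naturals, and the binomials are absorbed
   into them. *)
have h : \sum_(k < n.+1) (c (inord k) * 'C(n, k)%:R)
    *: (aw_monomial q k a * aw_monomial q (n - k) b) = 0.
  by apply: etrans e; apply: eq_bigr => i _; rewrite inord_val /bern scalerA.
pose d k := c (inord k) * 'C(n, k)%:R.
have /eqP := aw_products_free (c := d) q0 (charF 1) hab h kn; rewrite /d.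
by rewrite inord_val mulf_eq0 (negPf (bin_neq0 kn)) orbF => /eqP.
Qed.

(** Independence suffices, since the number of members equals the dimension n + 1. *)
Lemma bern_family_basis n a b : nonresonant q n a b ->
  basis_of fullv (bern_family q n a b).
Proof.
move=> hab; rewrite basisEfree subvf size_tuple dim_polyn leqnn !andbT.
apply/freeP => c e; apply: (bern_free hab).
move/(congr1 val): e; rewrite (@big_morph _ _ val 0%R +%R) // => e.
apply: etrans e; apply: eq_bigr => k _.
by rewrite -tnth_nth tnth_mktuple.
Qed.

End BernsteinBasis.

(** * Signs, and non-constancy of S_n *)

Section Positivity.
Variables (C : numFieldType) (q : C).
Hypotheses (hq0 : 0 < q) (hq1 : q < 1).
Implicit Types (a b c x : C) (n k : nat).

Lemma mulr_expr_lt1 c j : 0 <= c -> c < 1 -> c * q ^+ j < 1.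
Proof.
move=> c0; apply: le_lt_trans; rewrite ler_piMr //.
by rewrite exprn_ile1 // ltW.
Qed.

Lemma qpoch_gt0 c n : 0 <= c -> c < 1 -> 0 < qpoch c q n.
Proof.
by move=> c0 c1; apply: prodr_gt0 => j _; rewrite subr_gt0 mulr_expr_lt1.
Qed.

(** Only the first factor 1 - c is negative, because c q < 1. *)
Lemma qpoch_lt0 c n : (0 < n)%N -> 1 < c -> c < q^-1 -> qpoch c q n < 0.
Proof.
case: n => [//|n] _ c1 cq; have c0 : 0 < c by apply: lt_trans c1.
rewrite qpochSl nmulr_rlt0 ?subr_lt0 // qpoch_gt0 //.
  by rewrite mulr_ge0 // ltW.
by rewrite -ltr_pdivlMr // mul1r.
Qed.

Lemma qpoch_ratio_sign a b n : (0 < n)%N -> 0 < b -> b < a -> a / b < q^-1 ->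
  0 < qpoch (b / a) q n /\ qpoch (a / b) q n < 0.
Proof.
move=> n0 b0 ba ab; have a0 := lt_trans b0 ba; split.
  by rewrite qpoch_gt0 ?divr_ge0 ?ltW // ltr_pdivrMr // mul1r.
by rewrite qpoch_lt0 // ltr_pdivlMr // mul1r.
Qed.

Lemma aw_monomial_gt0 k a x :
  (forall j, 0 < (aw_factor (a * q ^+ j)).[x]) -> 0 < (aw_monomial q k a).[x].
Proof.
move=> h; elim: k => [|k IHk]; first by rewrite aw_monomial0 hornerC ltr01.
by rewrite aw_monomialSr hornerM mulr_gt0.
Qed.

Lemma bern_gt0 n k a b x : (k <= n)%N ->
    (forall j, 0 < (aw_factor (a * q ^+ j)).[x]) ->
    (forall j, 0 < (aw_factor (b * q ^+ j)).[x]) ->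
  0 < (bern q n a b k).[x].
Proof.
move=> kn ha hb; rewrite hornerZ hornerM mulr_gt0 ?ltr0n ?bin_gt0 //.
by rewrite mulr_gt0 ?aw_monomial_gt0.
Qed.

Lemma aw_factor_gt0 c x : 0 < c -> c < 1 -> x <= 1 -> 0 < (aw_factor c).[x].
Proof.
move=> c0 c1 x1; rewrite aw_factorE.
have -> : 1 - 2%:R * c * x + c ^+ 2 = (1 - c) ^+ 2 + 2%:R * c * (1 - x) by ring.
by apply: ltr_pwDl; rewrite ?exprn_gt0 ?mulr_ge0 ?subr_gt0 ?subr_ge0 // ltW.
Qed.

Lemma aw_factor_shift_gt0 a x : 0 < a -> a < 1 -> x <= 1 ->
  forall j, 0 < (aw_factor (a * q ^+ j)).[x].
Proof.
move=> a0 a1 x1 j; rewrite aw_factor_gt0 ?mulr_gt0 ?exprn_gt0 //.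
by rewrite mulr_expr_lt1 ?ltW.
Qed.

Lemma bern_sum_gt0 n a b x :
    (forall j, 0 < (aw_factor (a * q ^+ j)).[x]) ->
    (forall j, 0 < (aw_factor (b * q ^+ j)).[x]) ->
  0 < (bern_sum q n a b).[x].
Proof.
move=> ha hb; rewrite /bern_sum big_ord_recl hornerD ltr_pwDl ?bern_gt0 //.
by rewrite horner_sum sumr_ge0 // => k _; rewrite ltW // bern_gt0 // -ltnS.
Qed.

(** Serves parameters outside (0, 1): at x = 1 and x = -1 the factor is a perfect square. *)
Lemma aw_factor_pm1_gt0 c x : x ^+ 2 = 1 -> c * x < 0 -> 0 < (aw_factor c).[x].
Proof.
move=> x2 cx; rewrite aw_factorE.
have -> : 1 - 2%:R * c * x + c ^+ 2 = (1 - c * x) ^+ 2.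
  by rewrite sqrrB expr1n exprMn x2 mulr1 mul1r mulr2n; ring.
by rewrite exprn_gt0 // subr_gt0 (lt_trans cx).
Qed.

Lemma bern_sum_neq0_real n a b : a \is Num.real -> b \is Num.real ->
  qpoch (a * b) q n = 0 -> bern_sum q n a b <> 0.
Proof.
move=> ra rb /eqP; rewrite prodf_seq_eq0 => /hasP[j _ /=].
rewrite subr_eq0 => /eqP e S0.
have ab0 : 0 < a * b.
  by rewrite -(pmulr_lgt0 _ (exprn_gt0 j hq0)) -e ltr01.
(* An endpoint of sign opposite to both a and b makes every factor positive. *)
have key x : x ^+ 2 = 1 -> a * x < 0 -> b * x < 0 -> False.
  move=> x2 ax bx; suff : 0 < (bern_sum q n a b).[x] by rewrite S0 horner0 ltxx.
  by apply: bern_sum_gt0 => i; apply: aw_factor_pm1_gt0 => //;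
    rewrite mulrAC nmulr_rlt0 // exprn_gt0.
case: (real_ltgtP ra (real0 _)) => a0.
- by apply: (key 1); rewrite ?expr1n ?mulr1 // -(nmulr_rgt0 _ a0).
- apply: (key (-1)); rewrite ?sqrrN ?expr1n // mulrN1 oppr_lt0 //.
  by rewrite -(pmulr_rgt0 _ a0).
- by rewrite a0 mul0r ltxx in ab0.
Qed.

(** When (ab; q)_n = 0 both special values vanish and decide nothing; realness of a and b covers
    that case. *)
Lemma bern_sum_nonconstant n a b c : a != 0 -> b != 0 ->
    qpoch (b / a) q n != qpoch (a / b) q n ->
    (a \is Num.real /\ b \is Num.real) \/ qpoch (a * b) q n != 0 ->
  bern_sum q n a b <> c%:P.
Proof.
move=> a0 b0 ab h e.
have n2 : 2%:R != 0 :> C by rewrite pnatr_eq0.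
have [c0 ab0] := bern_sum_eqC n2 a0 b0 ab e.
case: h => [[ra rb]|]; last by rewrite ab0 eqxx.
by apply: (bern_sum_neq0_real ra rb ab0); rewrite e c0.
Qed.

End Positivity.

(** * Root sets, uniqueness and the exclusion lists *)

Lemma poly_root_seq (F : closedFieldType) (p : {poly F}) : p != 0 ->
  exists s : seq F, forall x, (x \in s) = root p x.
Proof.
move=> p0; have [s e] := closed_field_poly_normal p; exists s => x.
by rewrite e rootZ ?lead_coef_eq0 // root_prod_XsubC.
Qed.

Lemma partition_coef_uniq (F : fieldType) (q : F) n a b
    (p : 'I_n.+1 -> F) :
  q != 0 -> (forall i, i.+1%:R != 0 :> F) -> nonresonant q n a b ->
  partition_of_unity (fun k : 'I_n.+1 => p k *: bern q n a b k) ->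
  forall c : 'I_n.+1 -> F,
    partition_of_unity (fun k : 'I_n.+1 => c k *: bern q n a b k) <-> c =1 p.
Proof.
rewrite /partition_of_unity => q0 ch hab hp c; split=> [hc k|e]; last first.
  by apply: etrans hp; apply: eq_bigr => k _; rewrite e.
apply/eqP; rewrite -subr_eq0; apply/eqP.
apply: (bern_free q0 ch (c := fun k => c k - p k) hab).
under eq_bigr do rewrite scalerBl.
by rewrite big_split /= sumrN hc hp subrr.
Qed.

(** Differences j - i with 0 <= i, j <= n stay within absolute value n, so the excluded powers of q
    cover every resonance. *)
Lemma nonresonant_of_powers (F : fieldType) (q : F) n a b : q != 0 ->
  a != 0 -> b != 0 ->
  (forall t : nat, (t <= n.+1 - 1)%N -> a * b != q ^- t) ->
  (forall j : int, (`|j| <= n.+1 - 1)%N -> a / b != q ^ j) ->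
  nonresonant q n.+1 a b.
Proof.
rewrite subn1 /= => q0 a0 b0 hs hr.
split=> // [j jn|i j hi hj].
  apply: contraNneq (hs j jn) => e.
  by rewrite -[a * b](mulfK (expf_neq0 j q0)) e mul1r.
have : a / b != q ^ (j%:Z - i%:Z).
  apply: hr; clear -hi hj; lia.
rewrite expfzDr // -exprnN -exprnP; apply: contraNneq => e.
by rewrite eqr_div ?expf_neq0 // e mulrC.
Qed.

(** * The normalisation summing to unity and its signs *)

Section Normalisation.
Variables (C : numFieldType) (q : C).
Hypotheses (hq0 : 0 < q) (hq1 : q < 1).
Let q0 : q != 0. Proof. by rewrite gt_eqF. Qed.
Let qj j : q ^+ j.+1 != 1. Proof. by rewrite lt_eqF // exprn_ilt1 // ltW. Qed.
Let ch n : n.+1%:R != 0 :> C. Proof. by rewrite pnatr_eq0. Qed.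

(** Built on [unity_coef] rather than [pi_formula], so that the continued value is taken at the
    apparent singularities a = b q^n and b = a q^n. *)
Definition normalisation n a b (k : 'I_n.+1) : C :=
  unity_coef q k (n - k) a b / 'C(n, k)%:R.

Lemma normalisation_rational n a b (k : 'I_n.+1) : nonresonant q n a b ->
  rational_value (pi_formula q n k) a b (normalisation a b k).
Proof.
move=> hab; have kn : (k <= n)%N by rewrite -ltnS.
have := @rational_value_pi _ q q0 k (n - k) a b.
by rewrite subnKC //; apply.
Qed.

Lemma normalisation_sum n a b : nonresonant q n a b ->
  partition_of_unity
    (fun k : 'I_n.+1 => normalisation a b k *: bern q n a b k).
Proof.
move=> hab; apply: etrans (unity_coef_sum q0 qj hab); apply: eq_bigr => k _.
by rewrite scalerA divfK // bin_neq0 // -ltnS.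
Qed.

Lemma normalisation0 n a b :
  normalisation a b (@ord0 n) = (qpoch (a * b) q n * qpoch (b / a) q n)^-1.
Proof. by rewrite /normalisation subn0 bin0 divr1 unity_coef0n. Qed.

Lemma normalisation_max n a b :
  normalisation a b (@ord_max n) = (qpoch (a * b) q n * qpoch (a / b) q n)^-1.
Proof. by rewrite /normalisation subnn binn divr1 unity_coefn0. Qed.

(** (ab; q)_n is positive and exactly one of b/a and a/b lies in (1, 1/q), so exactly one of the two
    end coefficients is negative. *)
Lemma normalisation_negative n a b : (0 < n)%N ->
    0 < a -> a < 1 -> 0 < b -> b < 1 -> q < a / b -> a / b < q^-1 -> a != b ->
  normalisation a b (@ord0 n) * normalisation a b (@ord_max n) < 0 /\
  exists k : 'I_n.+1, normalisation a b k < 0.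
Proof.
move=> n0 a0 a1 b0 b1 qab abq ab; rewrite normalisation0 normalisation_max.
have S0 : 0 < qpoch (a * b) q n.
  by rewrite qpoch_gt0 ?mulr_ge0 ?ltW // (le_lt_trans _ a1) // ler_piMr ?ltW.
have baq : b / a < q^-1 by rewrite -invf_div ltf_pV2 // posrE divr_gt0.
case: (real_ltgtP (gtr0_real a0) (gtr0_real b0)) => [lt|lt|e].
- have [P N] := qpoch_ratio_sign hq0 hq1 n0 a0 lt baq; split.
    by rewrite nmulr_rlt0 ?invr_lt0 ?invr_gt0 ?pmulr_rlt0 ?mulr_gt0.
  by exists ord0; rewrite normalisation0 invr_lt0 pmulr_rlt0.
- have [P N] := qpoch_ratio_sign hq0 hq1 n0 b0 lt abq; split.
    by rewrite pmulr_rlt0 ?invr_lt0 ?invr_gt0 ?pmulr_rlt0 ?mulr_gt0.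
  by exists ord_max; rewrite normalisation_max invr_lt0 pmulr_rlt0.
- by rewrite e eqxx in ab.
Qed.

End Normalisation.

Theorem proposition3p1 (R : realType) (q : R[i]) (hq0 : 0 < q) (hq1 : q < 1) :
  (forall (n : nat) (a b : R[i]), a != 0 -> b != 0 ->
     (bern_sum q n a b).[x0 a] = qpoch (a * b) q n * qpoch (b / a) q n /\
     (bern_sum q n a b).[x0 b] = qpoch (a * b) q n * qpoch (a / b) q n)
  /\
  (forall n : nat, (0 < n)%N ->
     (forall a b : R[i], 0 < b -> b < a -> a < 1 -> a / b < q^-1 ->
        [/\ 0 < qpoch (b / a) q n, qpoch (a / b) q n < 0
          & qpoch (b / a) q n != qpoch (a / b) q n])
     /\
     (exists s : seq R[i], 1 \in s /\
        forall a b : R[i], a != 0 -> b != 0 ->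
          (qpoch (b / a) q n = qpoch (a / b) q n <->
           exists2 t, t \in s & b = t * a)))
  /\
  (forall (n : nat) (a b : R[i]), (0 < n)%N -> a != 0 -> b != 0 ->
     qpoch (b / a) q n != qpoch (a / b) q n ->
     ((a \is Num.real /\ b \is Num.real) \/ qpoch (a * b) q n != 0 ->
        [/\ ~ (exists c : R[i], bern_sum q n a b = c%:P),
            ~ partition_of_unity (fun k : 'I_n.+1 => bern q n a b k)
          & forall c : R[i],
              ~ partition_of_unity (fun k : 'I_n.+1 => c *: bern q n a b k)])
     /\
     ((forall t : nat, (1 <= t <= 2 * n - 1)%N -> a ^+ 2 != q ^- t) ->
      (forall t : nat, (t <= n - 1)%N -> a * b != q ^- t) ->
      (forall j : int, (`|j| <= n - 1)%N -> a / b != q ^ j) ->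
        basis_of fullv (bern_family q n a b) /\
        exists p : 'I_n.+1 -> R[i],
          [/\ forall k : 'I_n.+1,
                rational_value (pi_formula q n k) a b (p k),
              forall c : 'I_n.+1 -> R[i],
                partition_of_unity
                  (fun k : 'I_n.+1 => c k *: bern q n a b k) <-> c =1 p
            & 0 < a -> a < 1 -> 0 < b -> b < 1 ->
              q < a / b -> a / b < q^-1 -> a != b ->
              [/\ ~ bernstein_partition
                     (fun k : 'I_n.+1 => p k *: bern q n a b k),
                  forall (k : 'I_n.+1) (x : R[i]), -1 <= x <= 1 ->
                    0 < (bern q n a b k).[x],
                  p ord0 * p ord_max < 0
                & exists k : 'I_n.+1, forall x : R[i], -1 <= x <= 1 ->
                    (p k *: bern q n a b k).[x] < 0]])).
Proof.
have q0 : q != 0 by rewrite gt_eqF.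
have n2 : 2%:R != 0 :> R[i] by rewrite pnatr_eq0.
have ch i : i.+1%:R != 0 :> R[i] by rewrite pnatr_eq0.
split; first by move=> n a b a0 b0; rewrite bern_sum_x0l // bern_sum_x0r.
split=> [n n0|n a b n0 a0 b0 hne].
  split=> [a b b0 ba a1 ab|].
    have [P N] := qpoch_ratio_sign hq0 hq1 n0 b0 ba ab.
    by split=> //; rewrite gt_eqF // (lt_trans N).
  have [p p0 hp] := @qpoch_ratio_eq_roots _ q n q0 n0.
  have [s hs] := poly_root_seq p0; exists s; split.
    (* The root t = 1 comes from the pair a = b = 1. *)
    by rewrite hs -(divff (oner_neq0 _)) hp ?oner_neq0.
  move=> a b a0 b0; split=> [e|[t ts e]].
    by exists (b / a); rewrite ?divfK // hs hp // e.
  by apply/eqP; rewrite -hp // e mulfK // -hs.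
split=> [hreal|_ hs hr].
  have nc c := bern_sum_nonconstant hq0 (c := c) a0 b0 hne hreal.
  (* If c S_n = 1, then c is nonzero and S_n is the constant 1/c. *)
  have np c : ~ partition_of_unity (fun k : 'I_n.+1 => c *: bern q n a b k).
    rewrite /partition_of_unity -scaler_sumr => e.
    have c0 : c != 0.
      apply: contra_eqN e => /eqP ->.
      by rewrite scale0r eq_sym oner_neq0.
    apply: (nc c^-1); rewrite -[c^-1%:P]mulr1 -e mul_polyC.
    by rewrite scalerA mulVf // scale1r.
  split=> //; first by move=> [c /nc].
  move=> e; apply: (np 1); rewrite /partition_of_unity in e *.
  by apply: etrans e; apply: eq_bigr => k _; rewrite scale1r.
have hab : nonresonant q n a b.
  by case: n n0 hs hr {hne} => // n _ hs hr; apply: nonresonant_of_powers.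
split; first exact: bern_family_basis.
have hp := normalisation_sum hq0 hq1 hab.
exists (normalisation q a b); split.
- by move=> k; apply: normalisation_rational.
- exact: partition_coef_uniq.
move=> a_gt0 a1 b_gt0 b1 qab abq ab.
have [neg [k nk]] :=
  normalisation_negative hq0 hq1 n0 a_gt0 a1 b_gt0 b1 qab abq ab.
have pos (j : 'I_n.+1) x : -1 <= x <= 1 -> 0 < (bern q n a b j).[x].
  move=> /andP[_ x1]; apply: bern_gt0; first by rewrite -ltnS.
    exact: aw_factor_shift_gt0.
  exact: aw_factor_shift_gt0.
have negk x : -1 <= x <= 1 -> (normalisation q a b k *: bern q n a b k).[x] < 0.
  by move=> hx; rewrite hornerZ nmulr_rlt0 // pos.
split=> //; last by exists k.
(* Nonnegativity already fails at x = 0 for the member with negative coefficient. *)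
have h0 : -1 <= (0 : R[i]) <= 1 by rewrite ler01 lerN10.
by move=> [_ /(_ k 0 h0)]; rewrite lt_geF // negk.
Qed.
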